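(* For every positive integer $t$ there exists a constant $c_t>0$, depending only on $t$, such that for every positive integer $\mu$, every $K_{t,t}$-free graph $G$ with $\operatorname{tree-}\mu(G)\le \mu$ satisfies $$\operatorname{tree-}\alpha(G)\le c_t\cdot \mu^{3t^2+1}.$$ That is, $\operatorname{tree-}\alpha(G)=\mathcal{O}_t(\mu^{3t^2+1})$.
   Context: All graphs are finite, simple, and undirected. $K_{t,t}$ is the complete bipartite graph with both parts of size $t$. A graph $G$ is $H$-free if no induced subgraph of $G$ is isomorphic to $H$. An independent set is a set of pairwise nonadjacent vertices, and $\alpha(G)$ is the maximum size of an independent set in $G$. A matching is a set of pairwise disjoint edges; an induced matching in $G$ is a matching $M$ such that no two endpoints of distinct edges of $M$ are adjacent in $G$. A tree decomposition of a graph $G$ is a pair $\mathcal{T}=(T,\beta)$ consisting of a tree $T$ and a function $\beta$ assigning to each node $x\in V(T)$ a set $\beta(x)\subseteq V(G)$ (a bag) such that (i) for each edge of $G$ some bag contains both its endpoints, and (ii) for each vertex $v\in V(G)$, the set of nodes $x$ with $v\in\beta(x)$ induces a nonempty (connected) subtree of $T$. The independence number of $\mathcal{T}$ is $\alpha(\mathcal{T})=\max\{\alpha(G[\beta(x)]) : x\in V(T)\}$. The tree-independence number $\operatorname{tree-}\alpha(G)$ is the minimum of $\alpha(\mathcal{T})$ over all tree decompositions $\mathcal{T}$ of $G$. For $X\subseteq V(G)$, let $\mu(G,X)$ be the maximum cardinality of an induced matching $M$ in $G$ such that $e\cap X\ne\emptyset$ for all $e\in M$. The induced matching number of $\mathcal{T}$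 is $\mu(\mathcal{T})=\max\{\mu(G,\beta(x)) : x\in V(T)\}$. The induced matching treewidth $\operatorname{tree-}\mu(G)$ is the minimum of $\mu(\mathcal{T})$ over all tree decompositions $\mathcal{T}$ of $G$. The notation $\mathcal{O}_t(\cdot)$ means that the implied constant may depend on $t$ only. *)

(* Defs.v *)
From HB Require Import structures.
From mathcomp Require Import all_boot all_order all_algebra.
From mathcomp Require Import boolp reals.

Set Implicit Arguments.
Unset Strict Implicit.
Unset Printing Implicit Defensive.

Record sgraph := SGraph {
  vertex :> finType;
  adj : rel vertex;
  adj_sym : symmetric adj;
  adj_irrefl : irreflexive adj }.
Arguments adj {s} : rename.

Section Induced.
Variables (G : sgraph) (X : {set G}).

Definition induced_adj : rel {x : G | x \in X} :=
  fun u v => adj (val u) (val v).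

Lemma induced_adj_sym : symmetric induced_adj.
Proof. by move=> u v; rewrite /induced_adj adj_sym. Qed.

Lemma induced_adj_irrefl : irreflexive induced_adj.
Proof. by move=> u; rewrite /induced_adj adj_irrefl. Qed.

Definition induced : sgraph := SGraph induced_adj_sym induced_adj_irrefl.
End Induced.

Definition isomorphic (G H : sgraph) : Prop :=
  exists2 f : G -> H, bijective f & forall x y, adj (f x) (f y) = adj x y.

Definition induced_free (H G : sgraph) : Prop :=
  forall X : {set G}, ~ isomorphic (induced X) H.

Section CompleteBipartite.
Variable t : nat.

Definition Ktt_adj : rel ('I_t + 'I_t)%type :=
  fun x y => match x, y with
             | inl _, inr _ | inr _, inl _ => true
             | _, _ => false
             end.

Lemma Ktt_adj_sym : symmetric Ktt_adj.
Proof. by case=> i; case. Qed.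

Lemma Ktt_adj_irrefl : irreflexive Ktt_adj.
Proof. by case. Qed.

Definition Ktt : sgraph := SGraph Ktt_adj_sym Ktt_adj_irrefl.
End CompleteBipartite.

Definition independent (G : sgraph) (S : {set G}) : bool :=
  [forall x in S, forall y in S, ~~ adj x y].

Definition alpha (G : sgraph) : nat :=
  \max_(S : {set G} | independent S) #|S|.

Definition edges (G : sgraph) : {set {set G}} :=
  [set [set x; y] | x in G, y in G & adj x y].

Definition matching (G : sgraph) (M : {set {set G}}) : bool :=
  (M \subset edges G) && trivIset M.

Definition induced_matching (G : sgraph) (M : {set {set G}}) : bool :=
  matching M &&
  [forall e in M, forall f in M, (e != f) ==>
     [forall x in e, forall y in f, ~~ adj x y]].

(* The edges of M only have to meet X; the matching is induced in G, not in
   the subgraph of G induced by X. *)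
Definition mu (G : sgraph) (X : {set G}) : nat :=
  \max_(M : {set {set G}} |
        induced_matching M && [forall e in M, e :&: X != set0]) #|M|.

Definition connected (G : sgraph) : Prop := forall x y : G, connect adj x y.

Definition acyclic (G : sgraph) : Prop :=
  forall c : seq G, 2 < size c -> ~ ucycle adj c.

Definition is_tree (G : sgraph) : Prop :=
  [/\ 0 < #|G|, connected G & acyclic G].

Record tree_decomposition (G : sgraph) := TreeDecomposition {
  td_tree :> sgraph;
  td_bag : td_tree -> {set G};
  td_treeP : is_tree td_tree;
  td_edgeP : forall u v : G, adj u v ->
    exists x, (u \in td_bag x) && (v \in td_bag x);
  td_vertexP : forall v : G,
    is_tree (induced [set x : td_tree | v \in td_bag x]) }.

Definition td_alpha (G : sgraph) (T : tree_decomposition G) : nat :=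
  \max_(x : T) alpha (induced (td_bag x)).

Definition td_mu (G : sgraph) (T : tree_decomposition G) : nat :=
  \max_(x : T) mu (td_bag x).

(* The one-node decomposition, so that the minima below range over a nonempty
   set. *)
Section TrivialDecomposition.
Variable G : sgraph.

Definition point : sgraph :=
  @SGraph unit (fun _ _ => false) (fun _ _ => erefl) (fun _ => erefl).

Lemma point_tree : is_tree point.
Proof.
split; first by rewrite card_unit.
- by move=> [] []; exact: connect0.
- by move=> [|[] [|[] c]].
Qed.

Definition point_bag (x : point) : {set G} := [set: G].

Lemma point_edgeP (u v : G) : adj u v ->
  exists x : point, (u \in point_bag x) && (v \in point_bag x).
Proof. by exists tt; rewrite !inE. Qed.

Lemma point_vertexP (v : G) :
  is_tree (induced [set x : point | v \in point_bag x]).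
Proof.
have tt_in : (tt : point) \in [set x : point | v \in point_bag x].
  by rewrite !inE.
split.
- by apply/card_gt0P; exists (exist _ tt tt_in).
- move=> u w; have -> : u = w; last exact: connect0.
  by apply: val_inj; case: (val u); case: (val w).
- by case=> [|u [|w c]] // _ /andP[].
Qed.

Definition point_decomposition : tree_decomposition G :=
  TreeDecomposition point_tree point_edgeP point_vertexP.
End TrivialDecomposition.

Section Minimum.
Variables (A : Type) (a0 : A) (f : A -> nat).

Lemma min_over_ex : exists n, `[< exists a, f a = n >].
Proof. by exists (f a0); apply/asboolP; exists a0. Qed.

Definition min_over : nat := ex_minn min_over_ex.

Lemma min_over_attained : exists a, f a = min_over.
Proof. by rewrite /min_over; case: ex_minnP => n /asboolP. Qed.

Lemma min_over_le (a : A) : min_over <= f a.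
Proof.
rewrite /min_over; case: ex_minnP => n _; apply; apply/asboolP; by exists a.
Qed.
End Minimum.

Definition tree_alpha (G : sgraph) : nat :=
  min_over (point_decomposition G) (@td_alpha G).

Definition tree_mu (G : sgraph) : nat :=
  min_over (point_decomposition G) (@td_mu G).

(* Main.v *)
(* Put n = m + 1, h = t (8n)^t, d = h + 2t and k = 4nd, and call a vertex small
   if its neighbourhood contains no independent set of size k. Let S be a
   maximal independent set of small vertices. In a tree decomposition witnessing
   tree-mu <= m, replace every bag X by (X \ S) u N(S n X), and for each s in S
   hang a leaf with bag N[s] at some node whose bag contained s.
   - An independent set of n(2h+1) vertices of X that are not small yields an
     induced matching of size n touching X: by Kővári–Sós–Turán, adjacency
     between two independent sets is so sparse that its edges can be chosen
     greedily.
   - An independent set in N(S n X) is dominated by the independent set S n X,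
     and one of small vertices of X \ S is dominated by S, by maximality. A
     minimal dominating subset of S gives an induced matching touching X, so it
     has at most m elements, each with fewer than k neighbours in the given
     independent set.
   Hence every new bag has independence number at most n(2h+1) + 2mk, which is
   O_t(m^(t+2)), and t + 2 <= 3t^2 + 1. *)

Require Import Defs.
From HB Require Import structures.
From mathcomp Require Import all_boot all_order all_algebra.
From mathcomp Require Import boolp reals.
From mathcomp Require Import zify.

Set Implicit Arguments.
Unset Strict Implicit.
Unset Printing Implicit Defensive.

(** * Finite-set preliminaries *)

Lemma leq_card_bigcup (T I : finType) (P : pred I) (F : I -> {set T}) :
  #|\bigcup_(i | P i) F i| <= \sum_(i | P i) #|F i|.
Proof.
apply: (big_ind2 (fun (x : {set T}) n => #|x| <= n)) => [|x1 n1 x2 n2 h1 h2|//].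
  by rewrite cards0.
by rewrite (leq_trans (leq_card_setU _ _)) ?leq_add.
Qed.

Lemma subset_of_card (T : finType) (A : {set T}) n :
  n <= #|A| -> exists2 B : {set T}, B \subset A & #|B| = n.
Proof.
case/card_geqP => s [us ss sub]; exists [set x in s].
  by apply/subsetP => x; rewrite inE; apply: sub.
by rewrite cardsE (card_uniqP us).
Qed.

Definition nbh (G : sgraph) (v : G) : {set G} := [set u | adj v u].

Lemma independentP (G : sgraph) (S : {set G}) :
  reflect {in S &, forall x y, ~~ adj x y} (independent S).
Proof.
apply: (iffP forall_inP) => [H x y xS yS|H x xS].
  by have /forall_inP := H x xS; apply.
by apply/forall_inP => y yS; apply: H.
Qed.

(** * Induced matchings and domination *)

Section Graph.
Variable G : sgraph.
Implicit Types (A B D I J S X : {set G}) (u v w : G).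

Lemma independentS A B : A \subset B -> independent B -> independent A.
Proof.
move=> /subsetP sAB /independentP iB; apply/independentP => x y xA yA.
by apply: iB; apply: sAB.
Qed.

Lemma alpha_induced_le X b :
  (forall I, independent I -> I \subset X -> #|I| <= b) ->
  alpha (induced X) <= b.
Proof.
move=> H; apply/bigmax_leqP => S /independentP iS.
rewrite -(card_imset _ (val_inj : injective (val : induced X -> G))).
apply: H; last by apply/subsetP => _ /imsetP[u _ ->]; apply: (valP u).
apply/independentP => _ _ /imsetP[u uS ->] /imsetP[v vS ->].
by have := iS u v uS vS.
Qed.

(** The matching consists of the edges [[set x; f x]] with [x] in [D]. The third hypothesis is
    applied to both orders of a pair, so it also excludes adjacency between [f x] and [y]. *)
Lemma card_le_mu X D (f : G -> G) :
  independent D ->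
  {in D, forall x, adj x (f x)} ->
  {in D &, forall x y, x != y -> ~~ adj x (f y) && ~~ adj (f x) (f y)} ->
  {in D, forall x, (x \in X) || (f x \in X)} ->
  #|D| <= mu X.
Proof.
move=> /independentP iD fD indD XD.
pose E x : {set G} := [set x; f x].
(* Disjointness follows from non-adjacency: a vertex shared by two edges would be adjacent to its
   partner in one of them, which is a forbidden adjacency across. *)
have disjE : {in D &, forall x y, x != y ->
    forall u v, u \in E x -> v \in E y -> (u != v) && ~~ adj u v}.
  move=> x y xD yD xy u v.
  have /andP[xfy fxfy] := indD x y xD yD xy.
  have /andP[yfx _] := indD y x yD xD (contra_neq esym xy).
  have xyN := iD x y xD yD.
  rewrite !inE => /orP[]/eqP-> /orP[]/eqP->.
  - by rewrite xy.
  - rewrite xfy andbT; apply/eqP => e.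
    by have := fD y yD; rewrite -e adj_sym (negbTE xyN).
  - rewrite adj_sym yfx andbT; apply/eqP => e.
    by have := fD x xD; rewrite e (negbTE xyN).
  - rewrite fxfy andbT; apply/eqP => e.
    by have := fD x xD; rewrite e (negbTE xfy).
have injE : {in D &, injective E}.
  move=> x y xD yD eE; apply/eqP/contraT => xy.
  have xE : x \in E x by rewrite !inE eqxx.
  have := disjE x y xD yD xy x x xE; rewrite -eE => /(_ xE).
  by rewrite eqxx.
rewrite -(card_in_imset injE).
apply: (@leq_bigmax_cond _ _ (fun M : {set {set G}} => #|M|)).
apply/andP; split; last first.
  apply/forall_inP => _ /imsetP[x xD ->]; apply/set0Pn.
  by case/orP: (XD x xD) => ?; [exists x|exists (f x)]; rewrite !inE eqxx ?orbT.
apply/andP; split; last first.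
  apply/forall_inP => _ /imsetP[x xD ->].
  apply/forall_inP => _ /imsetP[y yD ->]; apply/implyP => ne.
  have xy : x != y by apply: contra_neq ne => ->.
  apply/forall_inP => u uE; apply/forall_inP => v vE.
  by have /andP[] := disjE x y xD yD xy u v uE vE.
apply/andP; split.
  apply/subsetP => _ /imsetP[x xD ->]; apply/imset2P; exists x (f x) => //.
  by rewrite inE; apply: fD.
apply/trivIsetP => _ _ /imsetP[x xD ->] /imsetP[y yD ->] ne.
have xy : x != y by apply: contra_neq ne => ->.
rewrite -setI_eq0; apply/eqP/setP => u; rewrite in_setI in_set0.
apply/negbTE/negP => /andP[uE uE'].
by have := disjE x y xD yD xy u u uE uE'; rewrite eqxx.
Qed.

(* In an inclusion-minimal subset of [D] dominating [J], every vertex has a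
   private neighbour in [J]; these pairs form an induced matching. *)
Lemma card_dominated_le X D J k :
  independent D -> independent J ->
  {in J, forall w, exists2 d, d \in D & adj d w} ->
  {in D, forall d, #|nbh d :&: J| <= k} ->
  {in D & J, forall d w, (d \in X) || (w \in X)} ->
  #|J| <= mu X * k.
Proof.
move=> iD iJ dom small touch.
pose P (C : {set G}) := [forall w in J, exists d in C, adj d w].
have PD : P D.
  apply/forall_inP => w wJ; have [d dD dw] := dom w wJ.
  by apply/existsP; exists d; rewrite dD.
have [C /minsetP[PC minC] sCD] := minset_exists PD.
have JC : J \subset \bigcup_(d in C) (nbh d :&: J).
  apply/subsetP => w wJ; have /forall_inP/(_ w wJ)/existsP[d /andP[dC dw]] := PC.
  by apply/bigcupP; exists d; rewrite // !inE dw.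
(* [f d] is a private neighbour of [d]; the default value [d] never occurs for [d] in [C]. *)
pose f d := odflt d [pick w in J | adj d w & [forall e in C, adj e w ==> (e == d)]].
have fP d : d \in C ->
    [/\ f d \in J, adj d (f d) & {in C, forall e, adj e (f d) -> e = d}].
  move=> dC; rewrite /f; case: pickP => [w /and3P[wJ dw /forall_inP pr]|none] /=.
    by split=> // e eC ew; apply/eqP; have /implyP := pr e eC; apply.
  (* If [d] had no private neighbour, every vertex of [J] that it dominates would have another
     dominator in [C], against minimality. *)
  suff PC' : P (C :\ d).
    have := minC _ PC' (subsetDl _ _) => /setP/(_ d).
    by rewrite dC !inE eqxx.
  apply/forall_inP => w wJ.
  have /forall_inP/(_ w wJ)/existsP[e /andP[eC ew]] := PC.
  have [eqed|ned] := eqVneq e d; last by apply/existsP; exists e; rewrite !inE ned eC.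
  subst e; have := none w; rewrite wJ ew /= => /negbT.
  rewrite negb_forall_in => /exists_inP[e' e'C]; rewrite negb_imply => /andP[e'w ne].
  by apply/existsP; exists e'; rewrite !inE ne e'C.
have sCD' := subsetP sCD.
apply: leq_trans (_ : #|C| * k <= _).
  apply: leq_trans (subset_leq_card JC) _.
  apply: leq_trans (_ : \sum_(d in C) #|nbh d :&: J| <= _).
    exact: leq_card_bigcup.
  rewrite -sum_nat_const; apply: leq_sum => d dC.
  exact/small/sCD'.
rewrite leq_mul2r; apply/orP; right; apply: (card_le_mu (f := f)).
- exact: independentS sCD iD.
- by move=> d /fP[].
- move=> d e dC eC de; have [fdJ _ pd] := fP d dC; have [feJ _ pe] := fP e eC.
  have -> : ~~ adj (f d) (f e) by apply: (independentP _ iJ).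
  rewrite andbT; apply/negP => /(pe d dC)/eqP.
  by rewrite (negbTE de).
- by move=> d dC; apply: touch; [exact: sCD'|have [] := fP d dC].
Qed.

(** * Bicliques and the Kővári-Sós-Turán bound *)

Lemma Ktt_of_biclique t A B :
  independent A -> independent B -> {in A & B, forall x y, adj x y} ->
  #|A| = t -> #|B| = t -> ~ induced_free (Ktt t) G.
Proof.
move=> /independentP iA /independentP iB cAB hA hB free.
pose X := A :|: B.
have disj : A :&: B = set0.
  apply/setP => x; rewrite !inE; apply/negbTE/negP => /andP[xA xB].
  by have := cAB x x xA xB; rewrite adj_irrefl.
pose a (i : 'I_t) : G := enum_val (cast_ord (esym hA) i).
pose b (i : 'I_t) : G := enum_val (cast_ord (esym hB) i).
have aA i : a i \in A by apply: enum_valP.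
have bB i : b i \in B by apply: enum_valP.
have aX i : a i \in X by rewrite inE aA.
have bX i : b i \in X by rewrite inE bB orbT.
pose g (z : 'I_t + 'I_t) : {x : G | x \in X} :=
  match z with inl i => exist _ (a i) (aX i) | inr i => exist _ (b i) (bX i) end.
have adjg x y : adj (val (g x)) (val (g y)) = Ktt_adj x y.
  case: x => i; case: y => j /=.
  - exact/negbTE/iA.
  - exact: cAB.
  - by rewrite adj_sym; exact: cAB.
  - exact/negbTE/iB.
have gI : injective g.
  move=> [i|i] [j|j] /(congr1 val) /= e.
  - by have /cast_ord_inj-> := enum_val_inj e.
  - by have := cAB _ _ (aA i) (bB j); rewrite e adj_irrefl.
  - by have := cAB _ _ (aA j) (bB i); rewrite e adj_irrefl.
  - by have /cast_ord_inj-> := enum_val_inj e.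
(* With injectivity of [g], this count makes [g] a bijection; its inverse is the required
   isomorphism. *)
have cX : #|{: 'I_t + 'I_t}| >= #|{: {x : G | x \in X}}|.
  rewrite card_sum !card_ord card_sig.
  apply: (@leq_trans #|X|).
    by apply: subset_leq_card; apply/subsetP => x; rewrite inE.
  by rewrite (leq_trans (leq_card_setU _ _)) // hA hB.
have [f gf fg] := inj_card_bij gI cX.
apply: (free X); exists f; first by exists g.
by move=> x y; rewrite -[in RHS](fg x) -[in RHS](fg y) /= /induced_adj adjg.
Qed.

(** After multiplication by the factorial of [t], the falling factorials compare factor by factor:
    for [i < t], the assumption [2 * t <= d] gives [2 * q * (d - i) >= q * d]. *)
Lemma bin_mul_le q d t : 2 * t <= d -> 'C(q * d, t) <= (2 * q) ^ t * 'C(d, t).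
Proof.
move=> td.
suff H : (q * d) ^_ t <= (2 * q) ^ t * d ^_ t.
  by have := fact_gt0 t => /leq_pmul2r <-; rewrite -mulnA !bin_ffact.
elim: t td => [|t IH] td; first by rewrite !ffactn0.
rewrite !ffactnSr expnSr.
have h2 : (q * d) ^_ t <= (2 * q) ^ t * d ^_ t by apply: IH; lia.
have h1 : q * d - t <= 2 * q * (d - t) by nia.
have := leq_mul h2 h1.
by rewrite mulnACA.
Qed.

(* Kővári–Sós–Turán, by counting the pairs [(a, T)] with [T] a [t]-subset of
   the neighbours of [a] in [B]. *)
Lemma KST t A B q d :
  induced_free (Ktt t) G -> independent A -> independent B ->
  #|B| <= q * d -> 2 * t <= d ->
  #|[set a in A | d <= #|nbh a :&: B|]| <= t * (2 * q) ^ t.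
Proof.
move=> free iA iB Bqd td; set H := [set a in A | _].
have Cd : 0 < 'C(d, t) by rewrite bin_gt0; lia.
rewrite -(leq_pmul2r Cd).
pose Ts := [set T : {set G} | T \subset B & #|T| == t].
apply: leq_trans (_ : \sum_(a in H) #|[set T : {set G} | T \subset nbh a :&: B & #|T| == t]| <= _).
  rewrite -sum_nat_const; apply: leq_sum => a; rewrite inE => /andP[aA da].
  by rewrite cards_draws leq_bin2l.
have -> : \sum_(a in H) #|[set T : {set G} | T \subset nbh a :&: B & #|T| == t]|
        = \sum_(T in Ts) #|[set a in H | T \subset nbh a]|.
  under eq_bigr do rewrite -sum1_card.
  under [RHS]eq_bigr do rewrite -sum1_card.
  rewrite (exchange_big_dep (mem Ts)) /=; last first.
    move=> a T _; rewrite !inE subsetI => /andP[/andP[_ ->] ->] //.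
  apply: eq_bigr => T; rewrite inE => /andP[TB Tt]; apply: eq_bigl => a.
  by rewrite !inE subsetI TB Tt !andbT.
(* More than [t] common neighbours of a [t]-set [T] would contain the second side of an induced
   [Ktt t]. *)
apply: leq_trans (_ : \sum_(T in Ts) t <= _).
  apply: leq_sum => T; rewrite inE => /andP[TB /eqP Tt].
  rewrite leqNgt; apply/negP => lt.
  have [A' sA' cA'] := subset_of_card (ltnW lt).
  have sA'' := subsetP sA'.
  apply: (@Ktt_of_biclique t A' T) => //.
  - apply: independentS iA; apply/subsetP => x /sA''.
    by rewrite !inE => /andP[/andP[]].
  - exact: independentS iB.
  - move=> x y /sA''; rewrite inE => /andP[_ /subsetP sub] /sub.
    by rewrite inE.
rewrite sum_nat_const cards_draws mulnC -mulnA leq_mul2l; apply/orP; right.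
apply: leq_trans (bin_mul_le q td).
exact: leq_bin2l.
Qed.

End Graph.

(** * Greedy selection and vertices with large neighbourhoods *)

(** Greedy choice: the average out-degree equals the average in-degree, so some vertex has
    out-degree at most [h]. Deleting it with its in- and out-neighbours costs at most [2 * h + 1]
    vertices. *)
Lemma sparse_digraph_independent (T : finType) (R : rel T) h n (I : {set T}) :
  {in I, forall w, #|[set v in I | R v w]| <= h} ->
  n * (2 * h).+1 <= #|I| ->
  exists J : {set T}, [/\ J \subset I, #|J| = n &
    {in J &, forall v w, v != w -> ~~ R v w}].
Proof.
elim: n I => [|n IH] I indeg hI.
  by exists set0; split; rewrite ?sub0set ?cards0 // => v w; rewrite inE.
have [v vI vout] : exists2 v, v \in I & #|[set w in I | R v w]| <= h.
  apply/exists_inP; apply/contraT; rewrite negb_exists_in => /forall_inP out.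
  have : \sum_(v in I) h.+1 <= \sum_(v in I) #|[set w in I | R v w]|.
    by apply: leq_sum => v vI; rewrite ltnNge out.
  have -> : \sum_(v in I) #|[set w in I | R v w]|
          = \sum_(w in I) #|[set v in I | R v w]|.
    under eq_bigr do rewrite -sum1_card.
    under [RHS]eq_bigr do rewrite -sum1_card.
    rewrite (exchange_big_dep (mem I)) /=; last by move=> v w _; rewrite inE => /andP[].
    by apply: eq_bigr => w wI; apply: eq_bigl => v; rewrite !inE wI.
  have : \sum_(w in I) #|[set v in I | R v w]| <= \sum_(w in I) h by apply: leq_sum.
  rewrite !sum_nat_const; nia.
pose Z := v |: ([set w in I | R v w] :|: [set w in I | R w v]).
have cZ : #|Z| <= (2 * h).+1.
  have := indeg v vI; move: vout.
  have := leq_card_setU [set w in I | R v w] [set w in I | R w v].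
  have := cardsU1 v ([set w in I | R v w] :|: [set w in I | R w v]).
  rewrite -/Z => -> [+ _]; case: (_ \notin _) => /=; lia.
have cIZ : #|I| <= #|I :\: Z| + #|Z|.
  have := cardsID Z I; have := subset_leq_card (subsetIr I Z); lia.
have [||J [JI cJ iJ]] := IH (I :\: Z).
- move=> w; rewrite inE => /andP[_ wI]; apply: leq_trans (indeg w wI).
  apply: subset_leq_card; apply/subsetP => u.
  by rewrite !inE => /andP[/andP[_ ->] ->].
- by rewrite mulSn in hI; lia.
have JP w : w \in J -> [/\ w \in I, w != v, ~~ R v w & ~~ R w v].
  move=> /(subsetP JI); rewrite !inE => /andP[+ wI].
  by rewrite wI /= !negb_or => /and3P[-> -> ->].
exists (v |: J); split.
- by apply/subsetP => w; rewrite !inE => /orP[/eqP->//|/JP[]].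
- rewrite cardsU1 cJ; case: (boolP (v \in J)) => // /JP[_].
  by rewrite eqxx.
- move=> a b; rewrite !inE => /orP[/eqP->|aJ] /orP[/eqP->|bJ].
  + by rewrite eqxx.
  + by case: (JP b bJ).
  + by case: (JP a aJ).
  + exact: iJ.
Qed.

Section Large.
Variable G : sgraph.
Implicit Types (A B D I J S X : {set G}) (u v w : G).

(** Induction on [#|J|]. At most [h] vertices of [B i] are bad for each other [B j], so a good
    vertex [a] exists. Removing its neighbours takes fewer than [d] vertices from each remaining
    set, within the [h + d] by which the required size drops. The bound [b] survives because the
    sets only shrink. *)
Lemma independent_transversal b d h J (B : G -> {set G}) :
  0 < d ->
  (forall A C, independent A -> independent C -> #|C| <= b ->
     #|[set a in A | d <= #|nbh a :&: C|]| <= h) ->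
  {in J, forall i, [/\ independent (B i), #|B i| <= b & #|J| * (h + d) <= #|B i|]} ->
  exists f : G -> G, {in J, forall i, f i \in B i} /\
    {in J &, forall i j, i != j -> ~~ adj (f i) (f j)}.
Proof.
move=> d0 kst; move cJ: #|J| => r; elim: r J cJ B => [|r IH] J cJ B HB.
  by exists id; move/eqP: cJ; rewrite cards_eq0 => /eqP->; split=> [i|i j]; rewrite inE.
have [i iJ] : exists i, i \in J by apply/card_gt0P; rewrite cJ.
have [iBi _ cBi] := HB i iJ.
have cJi : #|J :\ i| = r by have := cardsD1 i J; rewrite iJ cJ => -[].
pose bad := \bigcup_(j in J :\ i) [set a in B i | d <= #|nbh a :&: B j|].
have cbad : #|bad| <= r * h.
  apply: leq_trans (leq_card_bigcup _ _) _.
  rewrite -cJi -sum_nat_const; apply: leq_sum => j; rewrite !inE => /andP[_ jJ].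
  by have [iBj cBj _] := HB j jJ; apply: kst.
have /set0Pn[a] : B i :\: bad != set0.
  rewrite -card_gt0; have := cardsID bad (B i).
  have := subset_leq_card (subsetIr (B i) bad); nia.
rewrite inE => /andP[abad aB].
have [|f [fB iF]] := IH _ cJi (fun j => B j :\: nbh a).
  move=> j jJi; have [_ jJ] := setD1P jJi; have [iBj cBj sBj] := HB j jJ; split.
  - exact: independentS (subsetDl _ _) iBj.
  - exact: leq_trans (subset_leq_card (subsetDl _ _)) cBj.
  - have : #|nbh a :&: B j| < d.
      rewrite ltnNge; apply: contraNN abad => aj.
      by apply/bigcupP; exists j; rewrite // inE aB.
    rewrite setIC; have := cardsID (nbh a) (B j); move: sBj; rewrite mulSn; lia.
exists (fun j => if j == i then a else f j); split.
  move=> j jJ; case: eqVneq => [->//|ji].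
  by have := fB j; rewrite !inE ji jJ => /(_ isT)/andP[].
have fa j : j \in J -> j != i -> ~~ adj a (f j).
  by move=> jJ ji; have := fB j; rewrite !inE ji jJ => /(_ isT)/andP[].
move=> x y xJ yJ xy; case: ifP => [/eqP ex|/negbT xi]; case: ifP => [/eqP ey|/negbT yi].
- by rewrite ex ey eqxx in xy.
- exact: fa.
- by rewrite adj_sym; apply: fa.
- by apply: iF; rewrite // !inE ?xi ?yi.
Qed.

(* [R v w] below says that [v] sees at least [d] vertices of [A w]; by
   Kővári–Sós–Turán every in-degree is at most [h]. *)
Lemma large_neighbourhoods_le_mu t n d X I :
  let h := t * (8 * n) ^ t in
  induced_free (Ktt t) G -> 0 < d -> 2 * t <= d -> h <= d ->
  independent I -> I \subset X ->
  {in I, forall v, exists A, [/\ A \subset nbh v, independent A & #|A| = 4 * n * d]} ->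
  n * (2 * h).+1 <= #|I| -> n <= mu X.
Proof.
move=> h free d0 td hd iI IX large cI.
(* The bound [KST] with [q = 4 * n]; its factor [2 * q] is the [8 * n] in [h]. *)
have kst A C : independent A -> independent C -> #|C| <= 4 * n * d ->
    #|[set a in A | d <= #|nbh a :&: C|]| <= h.
  move=> iA iC cC; apply: leq_trans (KST free iA iC cC td) _.
  by rewrite /h mulnA.
have /choice[A AP] (v : G) : exists A, v \in I ->
    [/\ A \subset nbh v, independent A & #|A| = 4 * n * d].
  by case: (boolP (v \in I)) => [/large[A AP]|_]; [exists A|exists set0].
have [|J [JI cJ iJ]] := @sparse_digraph_independent _
    (fun v w => d <= #|nbh v :&: A w|) h n I _ cI.
  by move=> w /AP[_ iA cA]; apply: kst; rewrite ?cA.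
have sJI := subsetP JI.
(* Cutting out the neighbours of the other vertices of [J] makes any choice from [B w] private to
   [w]. Each of the [n - 1] others removes at most [d] vertices, so at least [3 * n * d] remain,
   more than the [n * (h + d)] needed since [h <= d]. *)
pose B w := A w :\: \bigcup_(v in J :\ w) nbh v.
have [|f [fB fI]] := independent_transversal (J := J) (B := B) d0 kst.
  move=> w wJ; have [_ iA cA] := AP w (sJI w wJ); split.
  - exact: independentS (subsetDl _ _) iA.
  - by rewrite -cA subset_leq_card ?subsetDl.
  - have : #|A w :&: \bigcup_(v in J :\ w) nbh v| <= #|J :\ w| * d.
      rewrite big_distrr /=; apply: leq_trans (leq_card_bigcup _ _) _.
      rewrite -sum_nat_const; apply: leq_sum => v; rewrite !inE => /andP[vw vJ].
      by rewrite setIC; have := iJ v w vJ wJ vw; rewrite -ltnNge => /ltnW.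
    have := cardsD1 w J; rewrite wJ cJ.
    have := cardsID (\bigcup_(v in J :\ w) nbh v) (A w); rewrite cA -/(B w).
    nia.
rewrite -cJ; apply: (card_le_mu (f := f)).
- exact: independentS JI iI.
- move=> v vJ; have [/subsetP sA _ _] := AP v (sJI v vJ).
  by have := fB v vJ; rewrite inE => /andP[_ /sA]; rewrite inE.
- move=> v w vJ wJ vw; rewrite fI // andbT; apply/negP => vfw.
  have := fB w wJ; rewrite inE => /andP[/negP nU _]; apply: nU.
  by apply/bigcupP; exists v; rewrite ?in_setD1 ?vw // inE.
- by move=> v vJ; rewrite (subsetP IX) ?sJI.
Qed.

End Large.

(** * Induced subgraphs of trees and pendant leaves *)

Lemma acyclic_induced (G : sgraph) (X : {set G}) : acyclic G -> acyclic (induced X).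
Proof.
move=> ac c c2 /andP[cyc uc]; apply: (ac (map val c)); first by rewrite size_map.
apply/andP; split; last by rewrite map_inj_uniq //; apply: val_inj.
by rewrite cycle_map.
Qed.

Definition induced_vertex (G : sgraph) (X : {set G}) (x : G) (xX : x \in X) : induced X :=
  exist (fun y => y \in X) x xX.

Lemma connect_induced (G H : sgraph) (X : {set G}) (Y : {set H}) (f : G -> H) :
  {in X, forall x, f x \in Y} ->
  {homo f : x y / adj x y} ->
  forall (u w : induced X) (fu : f (val u) \in Y) (fw : f (val w) \in Y),
    connect adj u w ->
    connect adj (induced_vertex fu) (induced_vertex fw).
Proof.
move=> fXY fadj u w fu fw /connectP[p]; elim: p u fu => [|a p IH] u fu /=.
  by move=> _ e; subst w; rewrite (bool_irrelevance fu fw) connect0.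
case/andP=> ua pa lw; have fa := fXY _ (valP a).
by apply: connect_trans (IH a fa pa lw); apply: connect1; apply: fadj.
Qed.

Section Hang.
Variables (T : sgraph) (V : finType) (f : V -> T).

Definition hang_adj : rel (T + V)%type := fun x y =>
  match x, y with
  | inl a, inl b => adj a b
  | inl a, inr v | inr v, inl a => a == f v
  | inr _, inr _ => false
  end.

Lemma hang_adj_sym : symmetric hang_adj.
Proof. by case=> a [b|b] //=; rewrite adj_sym. Qed.

Lemma hang_adj_irrefl : irreflexive hang_adj.
Proof. by case=> a //=; rewrite adj_irrefl. Qed.

Definition hang : sgraph := SGraph hang_adj_sym hang_adj_irrefl.

(** A cycle rotated to start at a leaf [inr v] would have [inl (f v)] both as its second and as its
    last vertex, which are distinct on a cycle of length at least three. A cycle that avoids the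
    leaves lies in [T]. *)
Lemma hang_acyclic : acyclic T -> acyclic hang.
Proof.
move=> ac c c2 uc.
have [/hasP[[//|v] vc _]|/hasPn noleaf] := boolP (has (fun z => if z is inr _ then true else false) c).
  have [i p Ec] := rot_to vc.
  have : ucycle (adj : rel hang) (rot i c) by rewrite rot_ucycle.
  move: c2; rewrite -(size_rot i) Ec /= => p2 /andP[] /=.
  case/lastP: p p2 {Ec} => [//|p z] p2; rewrite !rcons_path last_rcons.
  move=> /andP[/andP[pz _] zv].
  case: p p2 pz => [//|a p] _ /= /andP[va _] /and3P[_ + _].
  case: a va => [a /= /eqP->|//]; case: z zv => [z /= /eqP->|//].
  by rewrite mem_rcons inE eqxx.
have [c' Ec] : exists c', c = map inl c'.
  elim: (c : seq (T + V)) noleaf => [|z s IH] nl; first by exists [::].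
  have [|s' ->] := IH; first by move=> y ys; apply: nl; rewrite inE ys orbT.
  have := nl z; rewrite inE eqxx => /(_ isT); case: z {nl} => // a _.
  by exists (a :: s').
subst c; case/andP: uc => cyc uc; apply: (ac c'); first by rewrite size_map in c2.
apply/andP; split; first by rewrite cycle_map in cyc.
by rewrite map_inj_uniq in uc => // x y [].
Qed.

Lemma hang_connected : connected T -> connected hang.
Proof.
move=> con.
have inl_con a b : connect (adj : rel hang) (inl a) (inl b).
  have /connectP[p] := con a b; elim: p a => [|c p IH] a /=; first by move=> _ ->.
  by case/andP=> ac pc lb; apply: connect_trans (IH c pc lb); apply: connect1.
have to_inl z : exists a, connect (adj : rel hang) z (inl a).
  case: z => [a|v]; first by exists a.
  by exists (f v); apply: connect1 => /=; rewrite eqxx.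
move=> x y; have [a xa] := to_inl x; have [b yb] := to_inl y.
apply: connect_trans xa _; apply: connect_trans (inl_con a b) _.
by rewrite (sym_connect_sym (@adj_sym hang)).
Qed.

Lemma hang_tree : is_tree T -> is_tree hang.
Proof.
case=> T0 con ac; split; [|exact: hang_connected|exact: hang_acyclic].
by rewrite card_sum addn_gt0 T0.
Qed.

End Hang.

(** * The modified tree decomposition *)

Section Replace.
Variables (G : sgraph) (T : tree_decomposition G) (S : {set G}).
Hypothesis iS : independent S.

Lemma td_node_exists (v : G) : exists x : T, v \in td_bag x.
Proof.
have [/card_gt0P[x _] _ _] := td_vertexP T v.
by exists (val x); have := valP x; rewrite inE.
Qed.

Definition td_node (v : G) : T := xchoose (td_node_exists v).

Lemma td_nodeP v : v \in td_bag (td_node v).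
Proof. exact: (xchooseP (td_node_exists v)). Qed.

(* The leaf hung for [s \in S] carries the closed neighbourhood of [s]; the
   leaves hung for the other vertices are empty. *)
Definition replace_bag (z : hang td_node) : {set G} :=
  match z with
  | inl x => (td_bag x :\: S) :|: \bigcup_(s in S :&: td_bag x) nbh s
  | inr s => if s \in S then s |: nbh s else set0
  end.

(** An edge meeting [S] lies in the leaf bag of its end in [S]; any other edge survives in an old
    bag, which loses only vertices of [S]. *)
Lemma replace_edgeP (u v : G) : adj u v ->
  exists x, (u \in replace_bag x) && (v \in replace_bag x).
Proof.
move=> uv; case: (boolP (u \in S)) => [uS|uS].
  by exists (inr u); rewrite /= uS !inE eqxx uv orbT.
case: (boolP (v \in S)) => [vS|vS].
  by exists (inr v); rewrite /= vS !inE eqxx (adj_sym v) uv orbT.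
have [x /andP[ux vx]] := td_edgeP T uv.
by exists (inl x); rewrite /= !inE uS vS ux vx.
Qed.

(** Since [S] is independent, a vertex of [S] is in no neighbourhood of another one, so it survives
    only in its own leaf. *)
Lemma mem_replace_bagS (v : G) z : v \in S -> (v \in replace_bag z) = (z == inr v).
Proof.
move=> vS; have nadj s : s \in S -> adj s v = false.
  by move=> sS; apply/negbTE/(independentP _ iS).
case: z => [x|s] /=.
  rewrite !inE vS /=; apply/negbTE/negP => /bigcupP[s].
  by rewrite !inE => /andP[sS _]; rewrite nadj.
have -> : (inr s == inr v :> T + G) = (s == v) by [].
case: (boolP (s \in S)) => sS; first by rewrite !inE nadj // orbF eq_sym.
by rewrite inE; apply/esym/negbTE; apply: contraNneq sS => ->.
Qed.

(** For [v] outside [S], the nodes are the old subtree of [v], the old subtrees of its neighbours in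
    [S], and the leaves of those neighbours. The edge condition makes each neighbour's subtree meet
    that of [v], so everything connects to [root]. *)
Lemma replace_vertexP (v : G) :
  is_tree (induced [set x : hang td_node | v \in replace_bag x]).
Proof.
set Y := [set x | _].
have ac : acyclic (induced Y).
  by apply: acyclic_induced; have [_ _ ?] := hang_tree td_node (td_treeP T).
case: (boolP (v \in S)) => vS.
  have YE z : z \in Y -> z = inr v by rewrite inE mem_replace_bagS // => /eqP.
  have vY : (inr v : hang td_node) \in Y by rewrite inE mem_replace_bagS.
  split=> //; first by apply/card_gt0P; exists (induced_vertex vY).
  move=> x y; have -> : x = y; last exact: connect0.
  by apply: val_inj; rewrite (YE _ (valP x)) (YE _ (valP y)).
(* The disjunction treats the subtree of [v] and those of its neighbours in [S] uniformly. *)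
have inY (s : G) x : (s = v) \/ (s \in S /\ adj s v) -> s \in td_bag x ->
    (inl x : hang td_node) \in Y.
  rewrite !inE => -[->|[sS sv]] sx; first by rewrite vS sx.
  by apply/orP; right; apply/bigcupP; exists s; rewrite !inE ?sS.
pose r := td_node v; have rY := inY v r (or_introl erefl) (td_nodeP v).
pose root := induced_vertex rY.
have move_in s (sv : (s = v) \/ (s \in S /\ adj s v)) x y
    (sx : s \in td_bag x) (sy : s \in td_bag y) :
    connect adj (induced_vertex (inY s x sv sx)) (induced_vertex (inY s y sv sy)).
  have [_ con _] := td_vertexP T s.
  have xT : x \in [set x : T | s \in td_bag x] by rewrite inE.
  have yT : y \in [set x : T | s \in td_bag x] by rewrite inE.
  apply: (connect_induced (H := hang td_node) (f := inl) _ _ (u := induced_vertex xT) (w := induced_vertex yT)) => //.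
  by move=> z; rewrite inE; apply: inY.
have base x (xY : (inl x : hang td_node) \in Y) : connect adj (induced_vertex xY) root.
  have [s [sv sx]] : exists s, ((s = v) \/ (s \in S /\ adj s v)) /\ s \in td_bag x.
    move: (xY); rewrite !inE => /orP[/andP[_ vx]|/bigcupP[s]]; first by exists v; split; [left|].
    by rewrite !inE => /andP[sS sx] sv; exists s; split; [right|].
  (* The walk to [root] follows the subtree of [s] to [y], a node shared with [v], and then the
     subtree of [v]. *)
  have [y sy vy] : exists2 y : T, s \in td_bag y & v \in td_bag y.
    case: (sv) => [e|[_ adjsv]]; first by exists x; rewrite -?e.
    by have [y /andP[]] := td_edgeP T adjsv; exists y.
  have := move_in s sv x y sx sy; rewrite (bool_irrelevance (inY s x sv sx) xY).
  move/connect_trans; apply.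
  have := move_in v (or_introl erefl) y r vy (td_nodeP v).
  by rewrite (bool_irrelevance (inY s y sv sy) (inY v y (or_introl erefl) vy))
             (bool_irrelevance (inY v r _ _) rY).
have toroot (z : induced Y) : connect adj z root.
  case: z => -[x|s] zY; first exact: base.
  have [sS sv] : s \in S /\ adj s v.
    move: (zY); rewrite inE /=; case: (boolP (s \in S)) => sS; last by rewrite inE.
    by rewrite !inE => /orP[/eqP e|//]; rewrite e sS in vS.
  have fY := inY s (td_node s) (or_intror (conj sS sv)) (td_nodeP s).
  by apply: connect_trans (base _ fY); apply: connect1; rewrite /= /induced_adj /= eqxx.
split=> //; first by apply/card_gt0P; exists root.
move=> x y; apply: connect_trans (toroot x) _.
by rewrite (sym_connect_sym (@adj_sym (induced Y))).
Qed.

Definition replace : tree_decomposition G :=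
  TreeDecomposition (hang_tree td_node (td_treeP T)) replace_edgeP replace_vertexP.

End Replace.

(** * Small vertices and the final bound *)

Definition small (G : sgraph) k (v : G) : bool :=
  [forall A : {set G}, (A \subset nbh v) && independent A ==> (#|A| < k)].

Lemma small_card (G : sgraph) k (v : G) (J : {set G}) :
  small k v -> independent J -> #|nbh v :&: J| < k.
Proof.
move=> /forallP/(_ (nbh v :&: J))/implyP small iJ; apply: small.
by rewrite subsetIl (independentS (subsetIr _ _) iJ).
Qed.

Lemma not_small (G : sgraph) k (v : G) :
  ~~ small k v -> exists A : {set G}, [/\ A \subset nbh v, independent A & #|A| = k].
Proof.
rewrite negb_forall => /existsP[A]; rewrite negb_imply -leqNgt.
move=> /andP[/andP[Av iA] /subset_of_card[B BA cB]]; exists B; split=> //.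
  exact: subset_trans BA Av.
exact: independentS BA iA.
Qed.

Lemma td_alpha_replace (G : sgraph) (T : tree_decomposition G) (S : {set G})
    (iS : independent S) t m d :
  let h := t * (8 * m.+1) ^ t in
  let k := 4 * m.+1 * d in
  induced_free (Ktt t) G -> 0 < m -> td_mu T <= m -> 0 < d -> 2 * t <= d -> h <= d ->
  maxset (fun A : {set G} => independent A && (A \subset [set v | small k v])) S ->
  td_alpha (replace T iS) <= m.+1 * (2 * h).+1 + 2 * (m * k).
Proof.
move=> h k free m0 muT d0 td hd /maxsetP[/andP[_ /subsetP sS] maxS].
have Ssmall s : s \in S -> small k s by move=> /sS; rewrite inE.
(* A small vertex outside [S] without a neighbour in [S] could be added to [S], against
   maximality. *)
have Sdom v : small k v -> v \notin S -> exists2 s, s \in S & adj s v.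
  move=> sv vS; apply/exists_inP; apply: contraT; rewrite negb_exists_in => /forall_inP nS.
  move/negP: (vS); case; rewrite -(maxS (v |: S) _ (subsetUr _ _)) ?setU11 //.
  apply/andP; split; last first.
    by apply/subsetP => x; rewrite !inE => /orP[/eqP->//|/Ssmall].
  apply/independentP => x y; rewrite !inE => /orP[/eqP->|xS] /orP[/eqP->|yS].
  - by rewrite adj_irrefl.
  - by rewrite adj_sym nS.
  - exact: nS.
  - exact: (independentP _ iS).
have mu_bag x : mu (td_bag (t := T) x) <= m.
  by move/bigmax_leqP: muT; apply.
apply/bigmax_leqP => -[x|s] _; apply: alpha_induced_le => I iI IX; last first.
  move: IX; rewrite /=; case: ifP => [sS'|_]; last by rewrite subset0 => /eqP->; rewrite cards0.
  move=> IX; have := small_card (Ssmall s sS') iI.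
  (* A leaf bag contributes at most [1 + (k - 1)], hence at most [m * k]. *)
  have : #|I| <= #|[set s]| + #|nbh s :&: I|.
    apply: leq_trans (leq_card_setU _ _); apply: subset_leq_card.
    by apply/subsetP => u uI; have := subsetP IX u uI; rewrite !inE uI andbT.
  rewrite cards1; have : k <= m * k by rewrite leq_pmull.
  by clear -h; lia.
set X := td_bag x.
pose I1 := [set v in I | (v \in X) && ~~ small k v].
pose I2 := [set v in I | [&& v \in X, small k v & v \notin S]].
pose I3 := I :&: \bigcup_(s in S :&: X) nbh s.
have iI1 : independent I1 by apply: independentS iI; apply/subsetP=> v; rewrite inE => /andP[].
have iI2 : independent I2 by apply: independentS iI; apply/subsetP=> v; rewrite inE => /andP[].
have iI3 : independent I3 by apply: independentS iI; apply: subsetIl.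
have c1 : #|I1| <= m.+1 * (2 * h).+1.
  rewrite leqNgt; apply/negP => c1.
  have := mu_bag x; rewrite leqNgt => /negP; apply.
  apply: (large_neighbourhoods_le_mu free d0 td hd iI1 _ _ (ltnW c1)).
    by apply/subsetP=> v; rewrite inE => /and3P[].
  by move=> v; rewrite inE => /and3P[_ _ /not_small].
(* Used for [I2] with dominators in all of [S], and for [I3] with dominators in [S :&: X]. The
   matching edges meet [X] at the dominated end in the first case and at the dominator in the
   second. *)
have dom_le (J D : {set G}) : D \subset S -> independent J ->
    {in J, forall w, exists2 s, s \in D & adj s w} ->
    {in D & J, forall s w, (s \in X) || (w \in X)} -> #|J| <= m * k.
  move=> DS iJ dom touch; apply: leq_trans (_ : mu X * k <= _); last first.
    by rewrite leq_mul2r mu_bag orbT.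
  apply: (card_dominated_le (independentS DS iS) iJ dom _ touch) => s sD.
  by apply: ltnW; apply: small_card iJ; apply/Ssmall/(subsetP DS).
have c2 : #|I2| <= m * k.
  apply: (dom_le I2 S) => // [v|s v _]; rewrite inE; last by case/and4P=> _ ->; rewrite orbT.
  by case/and4P=> _ _; apply: Sdom.
have c3 : #|I3| <= m * k.
  apply: (dom_le I3 (S :&: X)) => // [|w|s w]; first exact: subsetIl.
    rewrite inE => /andP[_ /bigcupP[s sSX]]; rewrite inE => sw.
    by exists s.
  by rewrite inE => /andP[_ ->].
have cI : #|I| <= #|I1| + #|I2| + #|I3|.
  apply: leq_trans (_ : #|I1 :|: I2| + #|I3| <= _); last first.
    by rewrite leq_add2r leq_card_setU.
  apply: leq_trans (leq_card_setU _ _); apply/subset_leq_card/subsetP => v vI.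
  have := subsetP IX v vI; rewrite /= !in_setU !in_setI !in_setD !inE vI /=.
  by case/orP => [/andP[-> ->]|->]; rewrite ?orbT //=; case: small.
by apply: leq_trans cI _; rewrite mul2n -addnn; lia.
Qed.

Lemma tree_alpha_le (t m : nat) (G : sgraph) :
  0 < t -> 0 < m -> induced_free (Ktt t) G -> tree_mu G <= m ->
  tree_alpha G <= 54 * t * 16 ^ t * m ^ (3 * t ^ 2 + 1).
Proof.
move=> t0 m0 free; have [T eT] := min_over_attained (point_decomposition G) (@td_mu G).
rewrite /tree_mu -eT => muT; pose h := t * (8 * m.+1) ^ t; pose d := h + 2 * t.
pose P (A : {set G}) := independent A && (A \subset [set v | small (4 * m.+1 * d) v]).
have P0 : P set0.
  by rewrite /P sub0set andbT; apply/independentP => x y; rewrite inE.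
have [S maxS _] := maxset_exists P0.
have iS : independent S by have /maxsetP[/andP[]] := maxS.
have d0 : 0 < d by rewrite /d; lia.
have := td_alpha_replace iS free m0 muT d0 (leq_addl _ _) (leq_addr _ _) maxS.
rewrite -/h => le; apply: leq_trans (min_over_le _ _ _) (leq_trans le _).
have le_exp : m ^ t.+2 <= m ^ (3 * t ^ 2 + 1).
  by apply: leq_pexp2l => //; rewrite -mulnn; nia.
apply: leq_trans (leq_mul (leqnn _) le_exp).
pose q := 16 ^ t * m ^ t.
have hq : h <= t * q.
  by rewrite /h /q leq_mul2l -expnMn leq_exp2r //; apply/orP; right; lia.
have q0 : 0 < q by rewrite muln_gt0 !expn_gt0 m0.
have tq : t <= t * q by rewrite leq_pmulr.
(* With [a = t * q], the first summand is at most [6 * m * a] and the second at most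
   [8 * m * (6 * m * a)]; the total is at most [54 * m * m * a]. *)
have -> : 54 * t * 16 ^ t * m ^ t.+2 = 54 * (m * (m * (t * q))).
  by rewrite /q !expnS; move: (16 ^ t) (m ^ t) => E M; lia.
rewrite /d; clear -t0 m0 hq tq; move: (t * q) h hq tq => a h hq tq.
have mm : m <= m * m by rewrite leq_pmulr.
have ma : m * a <= m * (m * a) by rewrite leq_pmull.
have mma : (m.+1 * (h + 2 * t)) <= 2 * m * (3 * a) by apply: leq_mul; lia.
have mmma : (m.+1 * (2 * h).+1) <= 2 * m * (3 * a) by apply: leq_mul; lia.
have := leq_mul (leqnn m) mma.
by lia.
Qed.

Theorem theorem1p2 (R : realType) (t : nat) (ht : 0 < t) :
  exists c : R, (0 < c)%R /\
    forall (m : nat) (G : sgraph), 0 < m ->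
      induced_free (Ktt t) G -> tree_mu G <= m ->
      ((tree_alpha G)%:R <= c * m%:R ^+ (3 * t ^ 2 + 1)%N)%R.
Proof.
exists ((54 * t * 16 ^ t)%:R)%R; split.
  by rewrite Num.Theory.ltr0n !muln_gt0 ht expn_gt0.
move=> m G m0 free mum.
by rewrite -GRing.natrX -GRing.natrM Num.Theory.ler_nat; apply: tree_alpha_le.
Qed.
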